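(* Let $K$ be a field, $\lambda\in K$, and let $(A,\mu,1,\alpha,\beta)$ be a unitary BiHom-associative algebra over $K$ with $\alpha,\beta$ bijective. Let $\psi,\omega:A\to A$ be linear maps such that any two of $\alpha,\beta,\psi,\omega$ commute, $\psi(ab)=\psi(a)\psi(b)$, $\omega(ab)=\omega(a)\omega(b)$ for all $a,b\in A$, and $\psi(1)=1=\omega(1)$. Let $r=r^1\otimes r^2\in A\otimes A$ satisfy $(f\otimes f)(r)=r$ for each $f\in\{\alpha,\beta,\psi,\omega\}$. Then the linear map $\Delta_r:A\to A\otimes A$, $$\Delta_r(a)=\omega\alpha^{-1}(a)r^1\otimes\beta(r^2)-\alpha(r^1)\otimes r^2\,\psi\beta^{-1}(a)-\lambda(\omega(a)\otimes 1),$$ is a $\lambda$-BiHom-derivation.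
   Context: A BiHom-associative algebra $(A,\mu,\alpha,\beta)$ consists of a vector space $A$ and linear maps $\mu:A\otimes A\to A$ (written $ab$), $\alpha,\beta:A\to A$ with $\alpha\beta=\beta\alpha$, $\alpha(ab)=\alpha(a)\alpha(b)$, $\beta(ab)=\beta(a)\beta(b)$ and $\alpha(a)(bc)=(ab)\beta(c)$. It is unitary with unit $1$ if $\alpha(1)=1=\beta(1)$, $a1=\alpha(a)$, $1a=\beta(a)$ for all $a$. The notation $r=r^1\otimes r^2$ means a (suppressed) finite sum. With $\psi,\omega$ commuting with $\alpha,\beta$, a linear map $\delta:A\to A\otimes A$, $\delta(a)=a_{[1]}\otimes a_{[2]}$, is a $\lambda$-BiHom-derivation if $(f\otimes f)\circ\delta=\delta\circ f$ for $f\in\{\alpha,\beta,\psi,\omega\}$ and, for all $a,b\in A$, $$\delta(ab)=\omega(a)b_{[1]}\otimes\beta(b_{[2]})+\alpha(a_{[1]})\otimes a_{[2]}\psi(b)+\lambda\,\alpha\omega(a)\otimes\beta\psi(b).$$ *)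

(* Defs.v *)
From HB Require Import structures.
From mathcomp Require Import all_boot all_algebra generic_quotient ring_quotient.
From mathcomp Require Import freeg.
From mathcomp Require Import boolp.

Set Implicit Arguments.
Unset Strict Implicit.
Unset Printing Implicit Defensive.

Import GRing.Theory.

Local Open Scope ring_scope.
Local Open Scope quotient_scope.

(** Tensor product of two modules over a commutative ring: the free module
    on [V * W] modulo the submodule generated by the bilinearity relations. *)

Section TensorDef.
Variables (K : comNzRingType) (V W : lmodType K).

Local Notation F := {freeg (V * W)%type / K}.

Inductive tensor_rel : F -> Prop :=
| TensorRel0 : tensor_rel 0
| TensorRelP a x y of tensor_rel x & tensor_rel y : tensor_rel (a *: x + y)
| TensorRelL a v v' w :
    tensor_rel (<< (a *: v + v', w) >> - a *: << (v, w) >> - << (v', w) >>)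
| TensorRelR a v w w' :
    tensor_rel (<< (v, a *: w + w') >> - a *: << (v, w) >> - << (v, w') >>).

Definition tensor_relb : {pred F} := [pred x | `[< tensor_rel x >]].

Fact tensor_relb_zmod_closed : zmod_closed tensor_relb.
Proof.
split; first by apply/asboolP; exact: TensorRel0.
move=> x y /asboolP hx /asboolP hy; apply/asboolP.
by rewrite addrC -scaleN1r; exact: TensorRelP.
Qed.

HB.instance Definition _ :=
  GRing.isZmodClosed.Build F tensor_relb tensor_relb_zmod_closed.

Definition tensor := Quotient.quot tensor_relb.

HB.instance Definition _ := GRing.Zmodule.on tensor.
HB.instance Definition _ :
    @ZmodQuotient F (Quotient.equiv tensor_relb) 0 -%R +%R tensor :=
  ZmodQuotient.on tensor.

Let eq_tensor (x y : F) : \pi_tensor x = \pi_tensor y <-> tensor_rel (x - y).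
Proof.
have -> : (\pi_tensor x = \pi_tensor y) <-> x == y %[mod tensor].
  by split=> [->|/eqP].
by rewrite -Quotient.idealrBE; split=> /asboolP.
Qed.

Definition tensor_scale (a : K) (t : tensor) : tensor :=
  \pi_tensor (a *: repr t).

Let pi_scale a (x : F) : tensor_scale a (\pi_tensor x) = \pi_tensor (a *: x).
Proof.
apply/eq_tensor; rewrite -scalerBr -[_ *: _]addr0.
by apply: TensorRelP; [apply/eq_tensor; rewrite reprK | exact: TensorRel0].
Qed.

Fact tensor_scaleA a b t :
  tensor_scale a (tensor_scale b t) = tensor_scale (a * b) t.
Proof. by elim/quotW: t => x; rewrite (pi_scale b) !pi_scale scalerA. Qed.

Fact tensor_scale1 : left_id 1 tensor_scale.
Proof. by elim/quotW => x; rewrite pi_scale scale1r. Qed.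

Fact tensor_scaleDr : right_distributive tensor_scale +%R.
Proof.
move=> a; elim/quotW => x; elim/quotW => y.
by rewrite -raddfD !pi_scale scalerDr raddfD.
Qed.

Fact tensor_scaleDl t : {morph tensor_scale^~ t : a b / a + b}.
Proof. by elim/quotW: t => x a b; rewrite !pi_scale scalerDl raddfD. Qed.

HB.instance Definition _ := GRing.Zmodule_isLmodule.Build K tensor
  tensor_scaleA tensor_scale1 tensor_scaleDr tensor_scaleDl.

Definition tens (v : V) (w : W) : tensor := \pi_tensor << (v, w) >>.

Lemma tensPl a v v' w : tens (a *: v + v') w = a *: tens v w + tens v' w.
Proof.
rewrite /tens /GRing.scale /= pi_scale -raddfD; apply/eq_tensor.
by rewrite opprD addrA; exact: TensorRelL.
Qed.

Lemma tensPr a v w w' : tens v (a *: w + w') = a *: tens v w + tens v w'.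
Proof.
rewrite /tens /GRing.scale /= pi_scale -raddfD; apply/eq_tensor.
by rewrite opprD addrA; exact: TensorRelR.
Qed.

(** Every element is a finite sum of pure tensors. *)
Lemma tensor_ind (P : tensor -> Prop) :
  P 0 -> (forall v w t, P t -> P (tens v w + t)) -> forall t, P t.
Proof.
move=> P0 PD t; rewrite -[t]reprK.
elim/freeg_ind_dom0: (repr t) => [|k [v w] D _ _ IH]; first by rewrite raddf0.
suff /(PD (k *: v) w): P (\pi_tensor D).
  rewrite raddfD; congr (P (_ + _)).
  have := tensPl k v 0 w.
  rewrite addr0 => ->.
  have -> : tens 0 w = 0.
    by have := tensPl (-1) 0 0 w; rewrite scaler0 add0r scaleN1r addNr.
  rewrite addr0 /tens /GRing.scale /= pi_scale; congr (\pi_tensor _).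
  by apply/eqP/freeg_eqP => x; rewrite coeffZ !coeffU mul1r.
exact: IH.
Qed.

(** Universal property. *)
Section Lift.
Variables (U : lmodType K) (f : {bilinear V -> W -> U}).

Definition tensor_lift (t : tensor) : U := fglift (fun p => f p.1 p.2) (repr t).

Let lift0 := fglift (fun p : V * W => f p.1 p.2).

Let lift0B (x y : F) : lift0 (x - y) = lift0 x - lift0 y.
Proof. exact: lift_is_additive. Qed.

Let lift00 : lift0 0 = 0.
Proof. by rewrite -[0 in LHS](subrr 0) lift0B subrr. Qed.

Let lift0D (x y : F) : lift0 (x + y) = lift0 x + lift0 y.
Proof. by rewrite -{1}[y]opprK lift0B -[- y]add0r lift0B lift00 add0r opprK. Qed.

Let lift0Z a (x : F) : lift0 (a *: x) = a *: lift0 x.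
Proof.
elim/freeg_ind_dom0: x => [|k p D _ _ IH]; first by rewrite !scaler0 lift00 scaler0.
rewrite scalerDr !lift0D IH scalerDr; congr (_ + _).
have -> : a *: << k *g p >> = << a * k *g p >>.
  by apply/eqP/freeg_eqP => x; rewrite coeffZ !coeffU mulrA.
by rewrite /lift0 !liftU scalerA.
Qed.

Let lift0U p : lift0 << p >> = f p.1 p.2.
Proof. by rewrite /lift0 liftU scale1r. Qed.

Let lift0_rel x : tensor_rel x -> lift0 x = 0.
Proof.
elim=> {x} [|a x y _ IHx _ IHy|a v v' w|a v w w']; first exact: lift00.
- by rewrite lift0D lift0Z IHx IHy scaler0 addr0.
- by rewrite !lift0B lift0Z !lift0U /= linearPl addrAC addrK subrr.
- by rewrite !lift0B lift0Z !lift0U /= linearPr addrAC addrK subrr.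
Qed.

Let lift_pi (x : F) : tensor_lift (\pi_tensor x) = lift0 x.
Proof.
apply/eqP; rewrite -subr_eq0 -lift0B; apply/eqP/lift0_rel/eq_tensor.
by rewrite reprK.
Qed.

Fact tensor_lift_linear : linear tensor_lift.
Proof.
move=> a; elim/quotW => x; elim/quotW => y.
by rewrite /GRing.scale /= pi_scale -raddfD !lift_pi lift0D lift0Z.
Qed.

HB.instance Definition _ :=
  GRing.isLinear.Build K tensor U *:%R tensor_lift tensor_lift_linear.

Lemma tensor_liftE v w : tensor_lift (tens v w) = f v w.
Proof. by rewrite lift_pi lift0U. Qed.

End Lift.

Lemma tensor_ext (U : lmodType K) (g h : {linear tensor -> U}) :
  (forall v w, g (tens v w) = h (tens v w)) -> g =1 h.
Proof.
move=> gh; elim/tensor_ind => [|v w t IH]; first by rewrite !linear0.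
by rewrite !linearD gh IH.
Qed.

End TensorDef.

Notation "v ⊗ w" := (tens v w)
  (at level 40, left associativity) : ring_scope.

HB.instance Definition _ (K : comNzRingType) (V W : lmodType K) :=
  bilinear_isBilinear.Build K V W (tensor V W) *:%R *:%R (@tens K V W)
    (conj (fun w a v v' => tensPl a v v' w) (fun v a w w' => tensPr a v w w')).

Section TensorMap.
Variables (K : comNzRingType) (V V' W W' : lmodType K).
Variables (f : {linear V -> V'}) (g : {linear W -> W'}).

Definition tens_comp (v : V) (w : W) : tensor V' W' := f v ⊗ g w.

Fact tens_comp_bilinear : bilinear_for *:%R *:%R tens_comp.
Proof.
by split=> [w a v v'|v a w w']; rewrite /tens_comp linearP ?tensPl ?tensPr.
Qed.

HB.instance Definition _ :=
  bilinear_isBilinear.Build K V W (tensor V' W') *:%R *:%R tens_comp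
    tens_comp_bilinear.

(** The linear map [f ⊗ g]. *)
Definition tensor_map : tensor V W -> tensor V' W' := tensor_lift tens_comp.

HB.instance Definition _ := GRing.Linear.on tensor_map.

Lemma tensor_mapE v w : tensor_map (v ⊗ w) = f v ⊗ g w.
Proof. exact: tensor_liftE. Qed.

End TensorMap.

Section BiHom.
Variables (K : fieldType) (A : lmodType K).
Implicit Types (mu : {linear tensor A A -> A}) (alpha beta psi omega : {linear A -> A}).

Definition lmul mu (x y : A) : A := mu (x ⊗ y).
Definition rmul mu (y x : A) : A := mu (x ⊗ y).

Fact lmul_linear mu x : linear (lmul mu x).
Proof. by move=> a y y'; rewrite /lmul tensPr linearP. Qed.

Fact rmul_linear mu y : linear (rmul mu y).
Proof. by move=> a x x'; rewrite /rmul tensPl linearP. Qed.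

HB.instance Definition _ mu x :=
  GRing.isLinear.Build K A A *:%R (lmul mu x) (lmul_linear mu x).
HB.instance Definition _ mu y :=
  GRing.isLinear.Build K A A *:%R (rmul mu y) (rmul_linear mu y).

Definition commuting (f g : A -> A) := forall a, f (g a) = g (f a).

Definition mul_compatible mu (f : A -> A) :=
  forall a b, f (mu (a ⊗ b)) = mu (f a ⊗ f b).

Record bihom_associative mu alpha beta : Prop := BiHomAssociative {
  bihom_comm : commuting alpha beta;
  bihom_alphaM : mul_compatible mu alpha;
  bihom_betaM : mul_compatible mu beta;
  bihom_assoc : forall a b c,
    mu (alpha a ⊗ mu (b ⊗ c)) = mu (mu (a ⊗ b) ⊗ beta c)
}.

Record bihom_unit mu alpha beta (e : A) : Prop := BiHomUnit {
  bihom_alpha1 : alpha e = e;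
  bihom_beta1 : beta e = e;
  bihom_mulr1 : forall a, mu (a ⊗ e) = alpha a;
  bihom_mul1r : forall a, mu (e ⊗ a) = beta a
}.

(** In the Leibniz rule, [ω(a) b₁ ⊗ β(b₂)] is [(L_(ω a) ⊗ β) (δ b)] and
    [α(a₁) ⊗ a₂ ψ(b)] is [(α ⊗ R_(ψ b)) (δ a)], with [L], [R] the left and
    right multiplications. *)
Record bihom_derivation mu alpha beta psi omega (lam : K)
    (delta : A -> tensor A A) : Prop := BiHomDerivation {
  bihom_der_linear : linear delta;
  bihom_der_alpha : forall a, tensor_map alpha alpha (delta a) = delta (alpha a);
  bihom_der_beta : forall a, tensor_map beta beta (delta a) = delta (beta a);
  bihom_der_psi : forall a, tensor_map psi psi (delta a) = delta (psi a);
  bihom_der_omega : forall a, tensor_map omega omega (delta a) = delta (omega a);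
  bihom_der_leibniz : forall a b,
    delta (mu (a ⊗ b)) =
      tensor_map (lmul mu (omega a)) beta (delta b)
      + tensor_map alpha (rmul mu (psi b)) (delta a)
      + lam *: (alpha (omega a) ⊗ beta (psi b))
}.

(** [alphaV] and [betaV] stand for the inverses of [alpha] and [beta]. *)
Definition Delta mu (e : A) alpha beta psi omega (alphaV betaV : A -> A)
    (lam : K) (r : tensor A A) (a : A) : tensor A A :=
  tensor_map (lmul mu (omega (alphaV a))) beta r
  - tensor_map alpha (rmul mu (psi (betaV a))) r
  - lam *: (omega a ⊗ e).

End BiHom.

(* Main.v *)
(** [α(x)(yz) = (xy)β(z)], together with the invariance of [r] under [α] and
    [β], moves the product [ab] into the two [r]-terms of [Δ(ab)]. The mixed terms
    [ω(a)α(r₁) ⊗ β(r₂)ψ(b)] of the Leibniz rule cancel, and so does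
    [λ αω(a) ⊗ βψ(b)], since [1ψ(b) = βψ(b)]. *)

Require Import Defs.
From HB Require Import structures.
From mathcomp Require Import all_boot all_algebra.

Set Implicit Arguments.
Unset Strict Implicit.
Unset Printing Implicit Defensive.

Import GRing.Theory.
Local Open Scope ring_scope.

Section TensorMapTheory.
Variable K : comNzRingType.

Section Linear.
Variables (V V' W W' : lmodType K).
Variables (f : {linear V -> V'}) (g : {linear W -> W'}).

Lemma tensor_map0 : tensor_map f g 0 = 0.
Proof. exact: linear0. Qed.

Lemma tensor_mapD : {morph tensor_map f g : x y / x + y}.
Proof. exact: linearD. Qed.

Lemma tensor_mapB : {morph tensor_map f g : x y / x - y}.
Proof. exact: linearB. Qed.

Lemma tensor_mapZ c : {morph tensor_map f g : x / c *: x}.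
Proof. exact: linearZ. Qed.

End Linear.

(** Two composites of tensor maps are compared leg by leg, on pure tensors. Stating the two squares
    pointwise avoids packaging the composites as linear maps. *)
Lemma tensor_map_square (V V1 V2 V' W W1 W2 W' : lmodType K)
    (f' : {linear V1 -> V'}) (f : {linear V -> V1})
    (h' : {linear V2 -> V'}) (h : {linear V -> V2})
    (g' : {linear W1 -> W'}) (g : {linear W -> W1})
    (k' : {linear W2 -> W'}) (k : {linear W -> W2}) t :
  (forall v, f' (f v) = h' (h v)) -> (forall w, g' (g w) = k' (k w)) ->
  tensor_map f' g' (tensor_map f g t) = tensor_map h' k' (tensor_map h k t).
Proof.
move=> fh gk; elim/tensor_ind: t => [|v w t IH]; first by rewrite !tensor_map0.
by rewrite !tensor_mapD !tensor_mapE fh gk IH.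
Qed.

Variables (V V' W W' : lmodType K) (c : K).

(** The combination is a pointwise hypothesis so that [f], [f1], [f2] can be left multiplications by
    three different elements, as linearity of [Delta] requires. *)
Lemma tensor_map_linearl (f f1 f2 : {linear V -> V'}) (g : {linear W -> W'}) t :
  (forall v, f v = c *: f1 v + f2 v) ->
  tensor_map f g t = c *: tensor_map f1 g t + tensor_map f2 g t.
Proof.
move=> fE; elim/tensor_ind: t => [|v w t IH].
  by rewrite !tensor_map0 scaler0 addr0.
by rewrite !tensor_mapD !tensor_mapE fE tensPl IH scalerDr addrACA.
Qed.

Lemma tensor_map_linearr (f : {linear V -> V'}) (g g1 g2 : {linear W -> W'}) t :
  (forall w, g w = c *: g1 w + g2 w) ->
  tensor_map f g t = c *: tensor_map f g1 t + tensor_map f g2 t.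
Proof.
move=> gE; elim/tensor_ind: t => [|v w t IH].
  by rewrite !tensor_map0 scaler0 addr0.
by rewrite !tensor_mapD !tensor_mapE gE tensPr IH scalerDr addrACA.
Qed.

End TensorMapTheory.

Section DeltaTheory.
Variables (K : fieldType) (lam : K) (A : lmodType K).
Variables (mu : {linear tensor A A -> A}) (e : A).
Variables (alpha beta psi omega : {linear A -> A}) (alphaV betaV : A -> A).
Variable r : tensor A A.
Hypotheses (alphaK : cancel alpha alphaV) (alphaVK : cancel alphaV alpha).
Hypotheses (betaK : cancel beta betaV) (betaVK : cancel betaV beta).

Local Notation Dr := (Delta mu e alpha beta psi omega alphaV betaV lam r).

Lemma Delta_linear : linear Dr.
Proof.
move=> c a b; rewrite /Delta.
(* [alphaV] and [betaV] are bare functions; their linearity comes from being inverse to linear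
   maps. *)
rewrite (can2_linear alphaK alphaVK) (can2_linear betaK betaVK).
rewrite (linearP psi) !(linearP omega).
rewrite (@tensor_map_linearl _ _ _ _ _ c _
  (lmul mu (omega (alphaV a))) (lmul mu (omega (alphaV b)))); last first.
  (* As a function of its multiplier, left multiplication evaluated at [v] is right multiplication
     by [v]. *)
  by move=> v; exact: rmul_linear.
rewrite (@tensor_map_linearr _ _ _ _ _ c alpha _
  (rmul mu (psi (betaV a))) (rmul mu (psi (betaV b)))); last first.
  by move=> v; exact: lmul_linear.
rewrite tensPl !scalerDr !scalerN !scalerA [lam * c]mulrC !opprD.
by rewrite [X in X + _ = _]addrACA [LHS]addrACA.
Qed.

(** Since [f] also commutes with [alphaV] and [betaV], it passes through the coefficients and
    reaches [r], which absorbs it. This serves all four structure maps. *)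
Lemma Delta_natural (f : {linear A -> A}) :
  commuting f alpha -> commuting f beta ->
  commuting f psi -> commuting f omega ->
  mul_compatible mu f -> f e = e -> tensor_map f f r = r ->
  forall a, tensor_map f f (Dr a) = Dr (f a).
Proof.
move=> fal fbe fpsi fom fM fe fr a.
have falV x : f (alphaV x) = alphaV (f x).
  by apply: (can_inj alphaK); rewrite -fal !alphaVK.
have fbeV x : f (betaV x) = betaV (f x).
  by apply: (can_inj betaK); rewrite -fbe !betaVK.
rewrite /Delta !tensor_mapB tensor_mapZ tensor_mapE fom fe.
congr (_ - _ - _).
(* Expanding [r] as $(f\otimes f)(r)$ on the right makes both sides composites applied to [r]. *)
- rewrite -[in RHS]fr; apply: tensor_map_square => // x.
  by rewrite /lmul fM fom falV.
- rewrite -[in RHS]fr; apply: tensor_map_square => // x.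
  by rewrite /rmul fM fpsi fbeV.
Qed.

End DeltaTheory.

Theorem lemma3p5 (K : fieldType) (lam : K) (A : lmodType K)
    (mu : {linear tensor A A -> A}) (e : A)
    (alpha beta psi omega : {linear A -> A}) (alphaV betaV : A -> A)
    (r : tensor A A)
    (hA : bihom_associative mu alpha beta)
    (he : bihom_unit mu alpha beta e)
    (alphaK : cancel alpha alphaV) (alphaVK : cancel alphaV alpha)
    (betaK : cancel beta betaV) (betaVK : cancel betaV beta)
    (alpha_psi : commuting alpha psi) (alpha_omega : commuting alpha omega)
    (beta_psi : commuting beta psi) (beta_omega : commuting beta omega)
    (psi_omega : commuting psi omega)
    (psiM : mul_compatible mu psi) (omegaM : mul_compatible mu omega)
    (psi1 : psi e = e) (omega1 : omega e = e)
    (r_alpha : tensor_map alpha alpha r = r)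
    (r_beta : tensor_map beta beta r = r)
    (r_psi : tensor_map psi psi r = r)
    (r_omega : tensor_map omega omega r = r) :
  bihom_derivation mu alpha beta psi omega lam
    (Delta mu e alpha beta psi omega alphaV betaV lam r).
Proof.
have [al_be alM beM muA] := hA; have [al1 be1 mulx1 mul1x] := he.
have be_al : commuting beta alpha by move=> x; rewrite al_be.
have psi_al : commuting psi alpha by move=> x; rewrite alpha_psi.
have psi_be : commuting psi beta by move=> x; rewrite beta_psi.
have om_al : commuting omega alpha by move=> x; rewrite alpha_omega.
have om_be : commuting omega beta by move=> x; rewrite beta_omega.
have om_psi : commuting omega psi by move=> x; rewrite psi_omega.
split; try by apply: Delta_natural.
  exact: Delta_linear.
move=> a b; rewrite /Delta !tensor_mapB !tensor_mapZ.
have left_unit :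
    tensor_map (lmul mu (omega a)) beta (omega b ⊗ e)
    = omega (mu (a ⊗ b)) ⊗ e.
  by rewrite tensor_mapE be1 omegaM.
have right_unit :
    tensor_map alpha (rmul mu (psi b)) (omega a ⊗ e)
    = alpha (omega a) ⊗ beta (psi b).
  by rewrite tensor_mapE -mul1x.
have al_omV x : alpha (omega (alphaV x)) = omega x by rewrite alpha_omega alphaVK.
have be_psiV x : beta (psi (betaV x)) = psi x by rewrite beta_psi betaVK.
have alVM : alphaV (mu (a ⊗ b)) = mu (alphaV a ⊗ alphaV b).
  by apply: (can_inj alphaK); rewrite alM !alphaVK.
have beVM : betaV (mu (a ⊗ b)) = mu (betaV a ⊗ betaV b).
  by apply: (can_inj betaK); rewrite beM !betaVK.
(* Writing $\omega(a)=\alpha(\omega\alpha^{-1}(a))$, associativity gives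
   $\omega(a)(\omega\alpha^{-1}(b)x)=\omega\alpha^{-1}(ab)\beta(x)$; the extra $\beta$ on each leg
   is absorbed by [r_beta]. *)
have left_term :
    tensor_map (lmul mu (omega a)) beta
      (tensor_map (lmul mu (omega (alphaV b))) beta r)
    = tensor_map (lmul mu (omega (alphaV (mu (a ⊗ b))))) beta r.
  rewrite -[in RHS]r_beta; apply: tensor_map_square => // x.
  by rewrite /= /lmul -[omega a]al_omV muA alVM omegaM.
(* Symmetrically, $\psi(b)=\beta(\psi\beta^{-1}(b))$ gives
   $(x\,\psi\beta^{-1}(a))\psi(b)=\alpha(x)\,\psi\beta^{-1}(ab)$, and [r_alpha] absorbs $\alpha$. *)
have right_term :
    tensor_map alpha (rmul mu (psi b))
      (tensor_map alpha (rmul mu (psi (betaV a))) r)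
    = tensor_map alpha (rmul mu (psi (betaV (mu (a ⊗ b))))) r.
  rewrite -[in RHS]r_alpha; apply: tensor_map_square => // x.
  by rewrite /= /rmul -[psi b]be_psiV -muA beVM psiM.
have mixed_term :
    tensor_map (lmul mu (omega a)) beta
      (tensor_map alpha (rmul mu (psi (betaV b))) r)
    = tensor_map alpha (rmul mu (psi b))
        (tensor_map (lmul mu (omega (alphaV a))) beta r).
  (* The first legs agree by multiplicativity of $\alpha$, the second by that of $\beta$. *)
  apply: tensor_map_square => x.
    by rewrite /= /lmul alM al_omV.
  by rewrite /= /rmul beM be_psiV.
rewrite left_unit right_unit left_term right_term mixed_term.
set P := tensor_map _ _ r; set Q := tensor_map _ _ r.
set M := tensor_map _ _ (tensor_map _ _ r).
set L := lam *: _; set S := lam *: _.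
(* What remains is $P-Q-L=(P-M-L)+(M-Q-S)+S$. *)
by rewrite -[RHS]addrA subrK [P - M - L]addrAC [RHS]addrA subrK addrAC.
Qed.
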